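(* Let $f:\mathsf{On}\to\mathsf{On}$ be a normal function, with hyperation $\mathrm{Hyp}[f]=\langle f^\xi\rangle_{\xi\in\mathsf{On}}$ and Veblen progression $\mathrm{Veb}[f]=\langle f_\xi\rangle_{\xi\in\mathsf{On}}$. Then for every ordinal $\alpha$, $f^{\omega^\alpha}=f_\alpha$.
   Context: $\mathsf{On}$ is the class of all ordinals. A function $f:\mathsf{On}\to\mathsf{On}$ is normal if it is strictly increasing and continuous, i.e. $f(\lambda)=\sup_{\xi<\lambda}f(\xi)$ for every limit ordinal $\lambda$. A weak hyperation of a normal function $f$ is a family $\langle g^\xi\rangle_{\xi\in\mathsf{On}}$ of normal functions such that $g^0=\mathrm{id}$, $g^1=f$, and $g^{\xi+\zeta}=g^\xi\circ g^\zeta$ for all ordinals $\xi,\zeta$. The hyperation $\mathrm{Hyp}[f]=\langle f^\xi\rangle_{\xi\in\mathsf{On}}$ of $f$ is the unique (always existing) weak hyperation of $f$ which is pointwise minimal: $f^\xi(\zeta)\le h^\xi(\zeta)$ for every weak hyperation $\langle h^\xi\rangle_{\xi\in\mathsf{On}}$ of $f$ and all ordinals $\xi,\zeta$. The Veblen progression $\mathrm{Veb}[f]=\langle f_\alpha\rangle_{\alpha\in\mathsf{On}}$ is defined by: $f_0=f$ and, for $\alpha>0$, $f_\alpha$ is the normal function enumerating in increasing order the class $\{\xi\mid \forall\beta<\alpha,\ f_\beta(\xi)=\xi\}$. *)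

(* Defs.v *)
From Stdlib Require Import Classical ClassicalEpsilon FunctionalExtensionality
  PropExtensionality ProofIrrelevance Wellfounded.

(** * Ordinals

    No ordinal theory is available in the libraries, so the class [On] is built
    here: [Sup A b] stands for the least ordinal strictly above all the [b a],
    and [On] is the quotient of these trees by "[<=] in both directions", so
    that equality of ordinals is Leibniz equality.  Since [A] ranges over a
    universe [u], [On] plays the role of a proper class over the sets of [u],
    and arbitrary functions [On -> On] play the role of class functions.  The
    lemmas [lt_wf], [lt_trichotomy], [family_bounded], [below_bounded] and
    [wf_rank] give the properties that characterize this class. *)

Inductive tree : Type := Sup (A : Type) (b : A -> tree).

Definition arity (t : tree) : Type := match t with Sup A _ => A end.
Definition branch (t : tree) : arity t -> tree :=
  match t with Sup _ b => b end.

Fixpoint tle (s t : tree) : Prop :=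
  match s with Sup A b => forall a : A, exists c : arity t, tle (b a) (branch t c) end.
Definition tlt (s t : tree) : Prop := exists c : arity t, tle s (branch t c).
Definition teq (s t : tree) : Prop := tle s t /\ tle t s.

Lemma tle_refl t : tle t t.
Proof. induction t as [A b IH]; simpl; intros a; exists a; apply IH. Qed.

Lemma tle_trans s t u : tle s t -> tle t u -> tle s u.
Proof.
revert t u; induction s as [A b IH]; intros [B c] [C d]; simpl; intros H1 H2 a.
destruct (H1 a) as [x Hx]; destruct (H2 x) as [y Hy].
exists y; exact (IH a _ _ Hx Hy).
Qed.

Lemma tle_iff s t : tle s t <-> forall a, tlt (branch s a) t.
Proof. destruct s; reflexivity. Qed.

Lemma tbranch_lt t a : tlt (branch t a) t.
Proof. exists a; apply tle_refl. Qed.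

Lemma tlt_le_trans s t u : tlt s t -> tle t u -> tlt s u.
Proof.
intros [a Ha] H; rewrite tle_iff in H; destruct (H a) as [c Hc].
exists c; exact (tle_trans _ _ _ Ha Hc).
Qed.

Lemma tle_lt_trans s t u : tle s t -> tlt t u -> tlt s u.
Proof. intros H [c Hc]; exists c; exact (tle_trans _ _ _ H Hc). Qed.

Lemma tlt_le s t : tlt s t -> tle s t.
Proof.
revert t; induction s as [A b IH]; intros t H; simpl; intros a.
destruct H as [c Hc]; exists c.
exact (tle_trans _ _ _ (IH a _ (tbranch_lt (Sup A b) a)) Hc).
Qed.

Lemma tlt_acc s t : tle s t -> Acc tlt s.
Proof.
revert s; induction t as [A b IH]; intros s H; constructor; intros r Hr.
destruct (tlt_le_trans _ _ _ Hr H) as [a Ha]; exact (IH a r Ha).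
Qed.

Lemma tle_or_lt s t : tle s t \/ tlt t s.
Proof.
revert t; induction s as [A b IH]; intros t.
destruct (classic (exists a, tle t (b a))) as [[a Ha]|N].
- right; exists a; exact Ha.
- left; simpl; intros a.
  assert (H : tlt (b a) t).
  { apply NNPP; intros N2; apply N; exists a.
    clear N; revert N2; generalize (b a) as u; clear.
    induction t as [B c IHt]; intros u N2; simpl; intros x.
    apply NNPP; intros N3; apply N2; exists x; simpl.
    destruct u as [D d]; simpl in *; intros y.
    apply NNPP; intros N4; apply N3; exists y; apply IHt; exact N4. }
  exact H.
Qed.

Definition On : Type := { P : tree -> Prop | exists t, P = teq t }.

Definition cls (t : tree) : On := exist _ (teq t) (ex_intro _ t eq_refl).
Definition repr (x : On) : tree :=
  proj1_sig (constructive_indefinite_description _ (proj2_sig x)).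

Lemma reprK x : cls (repr x) = x.
Proof.
destruct x as [P HP]; unfold repr, cls; simpl.
destruct (constructive_indefinite_description _ HP) as [t Ht]; simpl.
subst P; f_equal; apply proof_irrelevance.
Qed.

Lemma cls_eq s t : cls s = cls t <-> teq s t.
Proof.
split.
- intros H; apply (f_equal (@proj1_sig _ _)) in H; simpl in H.
  rewrite H; split; apply tle_refl.
- intros [H1 H2]; assert (E : teq s = teq t).
  { apply functional_extensionality; intros u; apply propositional_extensionality.
    split; intros [H3 H4]; split; eauto using tle_trans. }
  unfold cls; revert E.
  generalize (ex_intro (fun u => teq s = teq u) s eq_refl).
  generalize (ex_intro (fun u => teq t = teq u) t eq_refl).
  intros p q E; revert p q; rewrite E; intros p q; f_equal; apply proof_irrelevance.
Qed.

Lemma repr_cls t : teq (repr (cls t)) t.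
Proof. apply cls_eq, reprK. Qed.

Definition le (x y : On) : Prop := tle (repr x) (repr y).
Definition lt (x y : On) : Prop := tlt (repr x) (repr y).

Declare Scope ord_scope.
Delimit Scope ord_scope with ord.
Bind Scope ord_scope with On.
Notation "x <= y" := (le x y) : ord_scope.
Notation "x < y" := (lt x y) : ord_scope.
Local Open Scope ord_scope.

Lemma cls_le s t : cls s <= cls t <-> tle s t.
Proof.
unfold le; destruct (repr_cls s), (repr_cls t).
split; intros H3; eauto using tle_trans.
Qed.

Lemma cls_lt s t : cls s < cls t <-> tlt s t.
Proof.
unfold lt; destruct (repr_cls s), (repr_cls t).
split; intros H3; eauto using tle_lt_trans, tlt_le_trans.
Qed.

Lemma le_refl x : x <= x.
Proof. apply tle_refl. Qed.

Lemma le_trans x y z : x <= y -> y <= z -> x <= z.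
Proof. apply tle_trans. Qed.

Lemma le_antisym x y : x <= y -> y <= x -> x = y.
Proof. intros; rewrite <- (reprK x), <- (reprK y); apply cls_eq; split; assumption. Qed.

Lemma lt_le x y : x < y -> x <= y.
Proof. apply tlt_le. Qed.

Lemma lt_le_trans x y z : x < y -> y <= z -> x < z.
Proof. apply tlt_le_trans. Qed.

Lemma le_lt_trans x y z : x <= y -> y < z -> x < z.
Proof. apply tle_lt_trans. Qed.

Lemma lt_wf : well_founded lt.
Proof.
intros x; unfold lt; apply (Acc_inverse_image _ _ tlt repr).
apply (tlt_acc _ (repr x)), tle_refl.
Qed.

Lemma lt_irrefl x : ~ x < x.
Proof. induction (lt_wf x) as [x _ IH]; intros H; exact (IH x H H). Qed.

Lemma le_or_lt x y : x <= y \/ y < x.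
Proof. apply tle_or_lt. Qed.

Lemma le_not_lt x y : x <= y <-> ~ y < x.
Proof.
split.
- intros H1 H2; exact (lt_irrefl _ (le_lt_trans _ _ _ H1 H2)).
- destruct (le_or_lt x y); tauto.
Qed.

Lemma lt_trichotomy x y : x < y \/ x = y \/ y < x.
Proof.
destruct (le_or_lt x y) as [H1|H1]; [|tauto].
destruct (le_or_lt y x) as [H2|H2]; [|tauto].
right; left; apply le_antisym; assumption.
Qed.

Lemma family_bounded (A : Type) (h : A -> On) : exists s, forall a, h a < s.
Proof.
exists (cls (Sup A (fun a => repr (h a)))); intros a.
rewrite <- (reprK (h a)) at 1; apply cls_lt; exists a; apply tle_refl.
Qed.

Lemma below_bounded (x : On) (F : On -> On) : exists s, forall y, y < x -> F y < s.
Proof.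
assert (K : forall t, exists s, forall y, y <= cls t -> F y < s).
{ induction t as [A b IH].
  destruct (choice _ IH) as [h Hh].
  destruct (family_bounded A h) as [s1 H1].
  destruct (family_bounded unit (fun _ => F (cls (Sup A b)))) as [s2 H2].
  assert (M : exists s, s1 <= s /\ s2 <= s).
  { destruct (le_or_lt s1 s2); eauto using le_refl, lt_le. }
  destruct M as [s [M1 M2]]; exists s; intros y Hy.
  destruct (lt_trichotomy y (cls (Sup A b))) as [L|[->|L]].
  - rewrite <- (reprK y) in L; apply (proj1 (cls_lt _ _)) in L; destruct L as [a La]; simpl in La.
    apply (proj2 (cls_le _ _)) in La; rewrite reprK in La.
    exact (lt_le_trans _ _ _ (Hh a y La) (le_trans _ _ _ (lt_le _ _ (H1 a)) M1)).
  - exact (lt_le_trans _ _ _ (H2 tt) M2).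
  - exfalso; exact (proj1 (le_not_lt _ _) Hy L). }
destruct (K (repr x)) as [s Hs]; exists s; intros y Hy; apply Hs.
rewrite reprK; exact (lt_le _ _ Hy).
Qed.

Lemma wf_rank (A : Type) (R : A -> A -> Prop) :
  well_founded R -> exists r : A -> On, forall a b, R a b -> r a < r b.
Proof.
intros W.
set (F := fun a (rec : forall b, R b a -> tree) =>
  Sup {b : A | R b a} (fun p => rec (proj1_sig p) (proj2_sig p))).
exists (fun a => cls (Fix W (fun _ => tree) F a)); intros a b H.
apply cls_lt; rewrite (Fix_eq W (fun _ => tree) F) with (x := b).
- exists (exist _ a H); apply tle_refl.
- intros x f g E; unfold F; f_equal; apply functional_extensionality; intros p; apply E.
Qed.

(** * Zero, successors, limits, suprema *)

Definition is_sup (P : On -> Prop) (s : On) : Prop :=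
  (forall x, P x -> x <= s) /\ (forall u, (forall x, P x -> x <= u) -> s <= u).

Definition tzero : tree := Sup False (fun e => match e with end).
Definition tsucc (t : tree) : tree := Sup unit (fun _ => t).

Definition zero : On := cls tzero.
Definition succ (x : On) : On := cls (tsucc (repr x)).
Definition one : On := succ zero.

Definition limit (l : On) : Prop := l <> zero /\ forall x, l <> succ x.

Lemma zero_le x : zero <= x.
Proof. rewrite <- (reprK x); apply cls_le; intros []. Qed.

Lemma lt_succ x y : x < succ y <-> x <= y.
Proof.
rewrite <- (reprK x) at 1; unfold succ; rewrite cls_lt; split.
- intros [c H]; exact H.
- intros H; exists tt; exact H.
Qed.

(** * Ordinal arithmetic

    Defined on trees by structural recursion on the right argument and
    transported to [On]; the usual recursion equations are derived below. *)

Definition tjoin (B : Type) (h : B -> tree) : tree :=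
  Sup {b : B & arity (h b)} (fun p => branch (h (projT1 p)) (projT2 p)).
Definition tmax (s t : tree) : tree :=
  tjoin bool (fun i => if i then s else t).

(* [x + y] is the maximum of [x] and the least ordinal above all [x + z], [z < y];
   [x * y] is the supremum of the [x * z + x], [z < y];
   [omega ^ y] is the maximum of [1] and of the [omega ^ z * omega], [z < y]. *)
Fixpoint tadd (x y : tree) : tree :=
  match y with Sup B c => tmax x (Sup B (fun b => tadd x (c b))) end.
Fixpoint tmul (x y : tree) : tree :=
  match y with Sup B c => tjoin B (fun b => tadd (tmul x (c b)) x) end.

Fixpoint tnat (n : nat) : tree :=
  match n with O => tzero | S m => tsucc (tnat m) end.
Definition tomega : tree := Sup nat tnat.

Fixpoint topow (y : tree) : tree :=
  match y with
  | Sup B c => tmax (tsucc tzero) (tjoin B (fun b => tmul (topow (c b)) tomega))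
  end.

Definition add (x y : On) : On := cls (tadd (repr x) (repr y)).
Definition mul (x y : On) : On := cls (tmul (repr x) (repr y)).
Definition omega : On := cls tomega.
Definition omega_pow (y : On) : On := cls (topow (repr y)).

Notation "x + y" := (add x y) : ord_scope.
Notation "x * y" := (mul x y) : ord_scope.

Lemma tjoin_le B h u : tle (tjoin B h) u <-> forall b, tle (h b) u.
Proof.
split.
- intros H b; apply tle_iff; intros a; exact (H (existT _ b a)).
- intros H [b a]; simpl; exact (proj1 (tle_iff _ _) (H b) a).
Qed.

Lemma tmax_le s t u : tle (tmax s t) u <-> tle s u /\ tle t u.
Proof.
unfold tmax; rewrite tjoin_le; split.
- intros H; split; [exact (H true)|exact (H false)].
- intros [H1 H2] []; assumption.
Qed.

Lemma tadd_le x y u :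
  tle (tadd x y) u <-> tle x u /\ forall b, tlt (tadd x (branch y b)) u.
Proof. destruct y as [B c]; simpl tadd; rewrite tmax_le, (tle_iff (Sup _ _)); reflexivity. Qed.

Lemma tmul_le x y u :
  tle (tmul x y) u <-> forall b, tle (tadd (tmul x (branch y b)) x) u.
Proof. destruct y as [B c]; simpl tmul; rewrite tjoin_le; reflexivity. Qed.

Lemma topow_le y u :
  tle (topow y) u <->
  tle (tsucc tzero) u /\ forall b, tle (tmul (topow (branch y b)) tomega) u.
Proof. destruct y as [B c]; simpl topow; rewrite tmax_le, tjoin_le; reflexivity. Qed.

Lemma tadd_mono x x' y y' : tle x x' -> tle y y' -> tle (tadd x y) (tadd x' y').
Proof.
intros Hx; revert y'; induction y as [B c IH]; intros y' Hy; apply tadd_le.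
pose proof (proj1 (tadd_le x' y' _) (tle_refl _)) as [K1 K2]; split.
- exact (tle_trans _ _ _ Hx K1).
- intros b; destruct (Hy b) as [d Hd]; exact (tle_lt_trans _ _ _ (IH b _ Hd) (K2 d)).
Qed.

Lemma tmul_mono x x' y y' : tle x x' -> tle y y' -> tle (tmul x y) (tmul x' y').
Proof.
intros Hx; revert y'; induction y as [B c IH]; intros y' Hy; apply tmul_le.
pose proof (proj1 (tmul_le x' y' _) (tle_refl _)) as K.
intros b; destruct (Hy b) as [d Hd].
refine (tle_trans _ _ _ _ (K d)); apply tadd_mono; [exact (IH b _ Hd)|exact Hx].
Qed.

Lemma topow_mono y y' : tle y y' -> tle (topow y) (topow y').
Proof.
revert y'; induction y as [B c IH]; intros y' Hy; apply topow_le.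
pose proof (proj1 (topow_le y' _) (tle_refl _)) as [K1 K2]; split; [exact K1|].
intros b; destruct (Hy b) as [d Hd].
refine (tle_trans _ _ _ _ (K2 d)); apply tmul_mono; [exact (IH b _ Hd)|apply tle_refl].
Qed.

Lemma cls_add s t : cls s + cls t = cls (tadd s t).
Proof. apply cls_eq; split; apply tadd_mono; apply repr_cls. Qed.

Lemma cls_mul s t : cls s * cls t = cls (tmul s t).
Proof. apply cls_eq; split; apply tmul_mono; apply repr_cls. Qed.

Lemma cls_omega_pow t : omega_pow (cls t) = cls (topow t).
Proof. apply cls_eq; split; apply topow_mono; apply repr_cls. Qed.

Lemma branch_lt x (b : arity (repr x)) : cls (branch (repr x) b) < x.
Proof. rewrite <- (reprK x) at 2; apply cls_lt, tbranch_lt. Qed.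

Lemma lt_branch x y : y < x -> exists b, y <= cls (branch (repr x) b).
Proof.
intros [b Hb]; exists b; rewrite <- (reprK y); apply cls_le; exact Hb.
Qed.

Lemma add_mono x x' y y' : x <= x' -> y <= y' -> x + y <= x' + y'.
Proof. intros; apply cls_le, tadd_mono; assumption. Qed.

Lemma mul_mono x x' y y' : x <= x' -> y <= y' -> x * y <= x' * y'.
Proof. intros; apply cls_le, tmul_mono; assumption. Qed.

Lemma omega_pow_mono y y' : y <= y' -> omega_pow y <= omega_pow y'.
Proof. intros; apply cls_le, topow_mono; assumption. Qed.

Lemma add_le x y u : x + y <= u <-> x <= u /\ forall z, z < y -> x + z < u.
Proof.
rewrite <- (reprK u); unfold add at 1; rewrite cls_le, tadd_le.
rewrite <- cls_le, !reprK; split; intros [H1 H2]; (split; [exact H1|]).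
- intros z Hz; destruct (lt_branch _ _ Hz) as [b Hb].
  apply (le_lt_trans _ (x + cls (branch (repr y) b)));
    [apply add_mono; auto using le_refl|].
  rewrite <- (reprK x), cls_add, <- (reprK u); apply cls_lt, H2.
- intros b; apply cls_lt; rewrite <- cls_add, !reprK; apply H2, branch_lt.
Qed.

Lemma mul_le x y u : x * y <= u <-> forall z, z < y -> x * z + x <= u.
Proof.
rewrite <- (reprK u); unfold mul at 1; rewrite cls_le, tmul_le; rewrite reprK; split.
- intros H z Hz; destruct (lt_branch _ _ Hz) as [b Hb].
  apply (le_trans _ (x * cls (branch (repr y) b) + x));
    [apply add_mono; auto using mul_mono, le_refl|].
  rewrite <- (reprK x), cls_mul, cls_add, <- (reprK u); apply cls_le, H.
- intros H b; apply cls_le; rewrite <- cls_add, <- cls_mul, !reprK; apply H, branch_lt.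
Qed.

Lemma omega_pow_le y u :
  omega_pow y <= u <-> one <= u /\ forall z, z < y -> omega_pow z * omega <= u.
Proof.
assert (E : one = cls (tsucc tzero)).
{ apply cls_eq; split; intros []; exists tt; apply repr_cls. }
rewrite <- (reprK u); unfold omega_pow at 1; rewrite cls_le, topow_le, reprK.
rewrite <- cls_le, <- E, reprK; split; intros [H1 H2]; (split; [exact H1|]).
- intros z Hz; destruct (lt_branch _ _ Hz) as [b Hb].
  apply (le_trans _ (omega_pow (cls (branch (repr y) b)) * omega));
    [apply mul_mono; auto using omega_pow_mono, le_refl|].
  unfold omega; rewrite cls_omega_pow, cls_mul, <- (reprK u); apply cls_le, H2.
- intros b; apply cls_le; rewrite <- cls_mul, <- cls_omega_pow, reprK; apply H2, branch_lt.
Qed.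

Lemma le_ext x y : (forall u, x <= u <-> y <= u) -> x = y.
Proof. intros H; apply le_antisym; apply H, le_refl. Qed.

Lemma not_lt_zero x : ~ x < zero.
Proof. apply le_not_lt, zero_le. Qed.

Lemma succ_le x y : succ x <= y <-> x < y.
Proof.
split.
- apply lt_le_trans, lt_succ, le_refl.
- intros H; apply le_not_lt; rewrite lt_succ, le_not_lt; tauto.
Qed.

Lemma limit_succ l x : limit l -> x < l -> succ x < l.
Proof.
intros [_ H] Hx; destruct (lt_trichotomy (succ x) l) as [L|[E|L]]; [exact L| |].
- elim (H x); auto.
- elim (lt_irrefl l); apply (le_lt_trans _ x); [apply lt_succ; exact L|exact Hx].
Qed.

Lemma zero_lt_limit l : limit l -> zero < l.
Proof.
intros [H _]; destruct (lt_trichotomy zero l) as [L|[E|L]]; [exact L| |].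
- elim H; auto.
- elim (not_lt_zero _ L).
Qed.

Lemma add_0_r x : x + zero = x.
Proof.
apply le_ext; intros u; rewrite add_le; split; [tauto|].
intros H; split; [exact H|intros z Hz; elim (not_lt_zero _ Hz)].
Qed.

Lemma add_succ_r x y : x + succ y = succ (x + y).
Proof.
apply le_ext; intros u; rewrite add_le, succ_le; split.
- intros [_ H]; apply H, lt_succ, le_refl.
- intros H; split.
  + apply (le_trans _ (x + y)); [|exact (lt_le _ _ H)].
    exact (proj1 (proj1 (add_le _ _ _) (le_refl _))).
  + intros z Hz; apply (le_lt_trans _ (x + y)); [|exact H].
    apply add_mono; [apply le_refl|apply lt_succ, Hz].
Qed.

Lemma add_limit_r x l : limit l -> is_sup (fun u => exists z, z < l /\ u = x + z) (x + l).
Proof.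
intros Hl; split.
- intros u [z [Hz ->]]; apply add_mono; [apply le_refl|exact (lt_le _ _ Hz)].
- intros u H; apply add_le; split.
  + apply H; exists zero; rewrite add_0_r; split; [apply zero_lt_limit, Hl|reflexivity].
  + intros z Hz; apply succ_le; rewrite <- add_succ_r; apply H.
    exists (succ z); split; [apply limit_succ; assumption|reflexivity].
Qed.

Lemma mul_0_r x : x * zero = zero.
Proof.
apply le_ext; intros u; rewrite mul_le; split; [intros _; apply zero_le|].
intros _ z Hz; elim (not_lt_zero _ Hz).
Qed.

Lemma mul_succ_r x y : x * succ y = x * y + x.
Proof.
apply le_ext; intros u; rewrite mul_le; split.
- intros H; apply H, lt_succ, le_refl.
- intros H z Hz; apply (le_trans _ (x * y + x)); [|exact H].
  apply add_mono; [apply mul_mono; [apply le_refl|apply lt_succ, Hz]|apply le_refl].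
Qed.

Lemma mul_limit_r x l : limit l -> is_sup (fun u => exists z, z < l /\ u = x * z) (x * l).
Proof.
intros Hl; split.
- intros u [z [Hz ->]]; apply mul_mono; [apply le_refl|exact (lt_le _ _ Hz)].
- intros u H; apply mul_le; intros z Hz; rewrite <- mul_succ_r; apply H.
  exists (succ z); split; [apply limit_succ; assumption|reflexivity].
Qed.

Lemma omega_limit : limit omega.
Proof.
split.
- intros H; apply cls_eq in H; destruct H as [H _]; destruct (H 0) as [[] _].
- intros x H; assert (L : x < omega) by (rewrite H; apply lt_succ, le_refl).
  rewrite <- (reprK x) in L; apply (proj1 (cls_lt _ _)) in L; destruct L as [n Hn]; simpl in Hn.
  assert (K : succ x < omega).
  { apply cls_lt; exists (S n); intros []; exists tt; exact Hn. }
  rewrite <- H in K; exact (lt_irrefl _ K).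
Qed.

Lemma omega_least l : limit l -> omega <= l.
Proof.
intros Hl; rewrite <- (reprK l); apply cls_le; intros n.
cut (cls (tnat n) < l); [rewrite <- (reprK l) at 1; apply cls_lt|].
induction n as [|n IH]; [apply zero_lt_limit, Hl|].
apply (le_lt_trans _ (succ (cls (tnat n)))); [|apply limit_succ; assumption].
apply cls_le; intros []; exists tt; apply repr_cls.
Qed.

Lemma omega_pow_0 : omega_pow zero = one.
Proof.
apply le_ext; intros u; rewrite omega_pow_le; split; [tauto|].
intros H; split; [exact H|intros z Hz; elim (not_lt_zero _ Hz)].
Qed.

Lemma le_mul_omega x : x <= x * omega.
Proof.
apply (le_trans _ (x * one)).
- unfold one; rewrite mul_succ_r.
  apply (le_trans _ (zero + x)); [|apply add_mono; [apply zero_le|apply le_refl]].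
  induction (lt_wf x) as [x _ IH]; apply le_not_lt; intros H.
  pose proof (IH _ H) as K; apply (lt_irrefl (zero + x)).
  apply (le_lt_trans _ (zero + (zero + x))); [exact K|].
  exact (proj2 (proj1 (add_le zero x _) (le_refl _)) _ H).
- apply mul_mono; [apply le_refl|].
  apply lt_le, limit_succ; [apply omega_limit|apply zero_lt_limit, omega_limit].
Qed.

Lemma omega_pow_succ y : omega_pow (succ y) = omega_pow y * omega.
Proof.
apply le_ext; intros u; rewrite omega_pow_le; split.
- intros [_ H]; apply H, lt_succ, le_refl.
- intros H; split.
  + apply (le_trans _ (omega_pow y)); [exact (proj1 (proj1 (omega_pow_le _ _) (le_refl _)))|].
    exact (le_trans _ _ _ (le_mul_omega _) H).
  + intros z Hz; apply (le_trans _ (omega_pow y * omega)); [|exact H].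
    apply mul_mono; [apply omega_pow_mono, lt_succ, Hz|apply le_refl].
Qed.

Lemma omega_pow_limit l :
  limit l -> is_sup (fun u => exists z, z < l /\ u = omega_pow z) (omega_pow l).
Proof.
intros Hl; split.
- intros u [z [Hz ->]]; apply omega_pow_mono; exact (lt_le _ _ Hz).
- intros u H; apply omega_pow_le; split.
  + rewrite <- omega_pow_0; apply H.
    exists zero; split; [apply zero_lt_limit, Hl|reflexivity].
  + intros z Hz; rewrite <- omega_pow_succ; apply H.
    exists (succ z); split; [apply limit_succ; assumption|reflexivity].
Qed.

(** * Normal functions, hyperations, Veblen progressions *)

Definition normal (f : On -> On) : Prop :=
  (forall x y, x < y -> f x < f y) /\
  (forall l, limit l -> is_sup (fun u => exists x, x < l /\ u = f x) (f l)).

Definition weak_hyperation (f : On -> On) (g : On -> On -> On) : Prop :=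
  (forall x, normal (g x)) /\
  (forall z, g zero z = z) /\
  (forall z, g one z = f z) /\
  (forall x y z, g (x + y) z = g x (g y z)).

Definition is_hyperation (f : On -> On) (g : On -> On -> On) : Prop :=
  weak_hyperation f g /\
  forall h, weak_hyperation f h -> forall x z, g x z <= h x z.

(* Definite description: [is_hyperation f] has at most one solution by
   [hyperation_unique].  The default value of [epsilon] is returned only if there is
   none, so a statement about [Hyp f] carries the existence of the hyperation. *)
Definition Hyp (f : On -> On) : On -> On -> On :=
  epsilon (inhabits (fun _ z => z)) (is_hyperation f).

Lemma hyperation_unique f g h : is_hyperation f g -> is_hyperation f h -> g = h.
Proof.
intros [Hg Mg] [Hh Mh]; apply functional_extensionality; intros x.
apply functional_extensionality; intros z; apply le_antisym; auto.
Qed.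

Definition is_enumeration (P : On -> Prop) (e : On -> On) : Prop :=
  normal e /\ forall x, P x <-> exists z, e z = x.

(* Same convention as for [Hyp]; see [enumeration_unique]. *)
Definition enum (P : On -> Prop) : On -> On :=
  epsilon (inhabits (fun z => z)) (is_enumeration P).

Lemma enumeration_unique P e e' : is_enumeration P e -> is_enumeration P e' -> e = e'.
Proof.
assert (K : forall e e', is_enumeration P e -> is_enumeration P e' -> forall z,
          (forall y, y < z -> e y = e' y) -> e z <= e' z).
{ clear; intros e e' [[I _] He] [[I' _] He'] z IH.
  assert (Hz : P (e' z)) by (apply He'; exists z; reflexivity).
  apply He in Hz; destruct Hz as [w Hw]; rewrite <- Hw.
  destruct (lt_trichotomy z w) as [L|[->|L]].
  - exact (lt_le _ _ (I _ _ L)).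
  - apply le_refl.
  - elim (lt_irrefl (e' w)); rewrite <- (IH w L) at 2; rewrite Hw; exact (I' _ _ L). }
intros H H'; apply functional_extensionality; intros z.
induction (lt_wf z) as [z _ IH]; apply le_antisym; apply K; auto.
intros y Hy; symmetry; auto.
Qed.

Definition Veb (f : On -> On) : On -> On -> On :=
  Fix lt_wf (fun _ => On -> On) (fun a rec =>
    if excluded_middle_informative (a = zero) then f
    else enum (fun x => forall b (Hb : b < a), rec b Hb x = x)).

Lemma Veb_eq f a :
  Veb f a = if excluded_middle_informative (a = zero) then f
            else enum (fun x => forall b, b < a -> Veb f b x = x).
Proof.
unfold Veb at 1; rewrite Fix_eq; [reflexivity|].
clear a; intros a r r' E.
assert (E2 : r = r').
{ apply functional_extensionality_dep; intros b.
  apply functional_extensionality_dep; intros Hb; apply E. }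
rewrite E2; reflexivity.
Qed.

Lemma Veb_0 f : Veb f zero = f.
Proof. rewrite Veb_eq; destruct excluded_middle_informative; tauto. Qed.

Lemma Veb_pos f a :
  zero < a -> Veb f a = enum (fun x => forall b, b < a -> Veb f b x = x).
Proof.
intros H; rewrite Veb_eq; destruct excluded_middle_informative as [->|]; [|reflexivity].
elim (lt_irrefl _ H).
Qed.

(* Main.v *)
From Stdlib Require Import Classical ClassicalEpsilon FunctionalExtensionality.
Require Import Defs.

(** The hyperation is built from the Veblen progression: writing an ordinal as a
    finite sum of powers [omega ^ a1 + ... + omega ^ an], one composes
    [Veb f a1], ..., [Veb f an].  The result does not depend on the sum chosen,
    because a term [omega ^ b] absorbed by a later [omega ^ a], [b < a],
    corresponds to [Veb f b] fixing the values of [Veb f a]; additivity is then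
    concatenation of sums.  It is minimal because in any weak hyperation [h] the
    equation [omega ^ b + omega ^ a = omega ^ a] makes the values of
    [h (omega ^ a)] fixed points of [h (omega ^ b)], which dominates [Veb f b]. *)

Local Open Scope ord_scope.

(** * Least elements and suprema *)

Lemma lt_trans x y z : x < y -> y < z -> x < z.
Proof. intros H1 H2; exact (lt_le_trans _ _ _ H1 (lt_le _ _ H2)). Qed.

Lemma lt_not_le x y : x < y <-> ~ y <= x.
Proof. rewrite le_not_lt; split; [tauto|apply NNPP]. Qed.

Lemma least_element (P : On -> Prop) :
  (exists x, P x) -> exists x, P x /\ forall y, P y -> x <= y.
Proof.
intros [x Hx]; apply NNPP; intros N; revert Hx.
induction (lt_wf x) as [x _ IH]; intros Hx.
apply N; exists x; split; [exact Hx|].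
intros y Hy; apply le_not_lt; intros L; exact (IH y L Hy).
Qed.

Lemma sup_exists (P : On -> Prop) b :
  (forall x, P x -> x <= b) -> exists s, is_sup P s.
Proof.
intros H.
destruct (least_element (fun s => forall x, P x -> x <= s)) as [s Hs]; [eauto|].
exists s; exact Hs.
Qed.

Lemma lt_sup P s x : is_sup P s -> x < s -> exists y, P y /\ x < y.
Proof.
intros [_ H] L; apply NNPP; intros N.
apply (proj1 (lt_not_le _ _) L), H; intros y Hy.
apply le_not_lt; intros K; apply N; eauto.
Qed.

Lemma sup_limit P s x : is_sup P s -> P x -> ~ P s -> limit s.
Proof.
intros Hs Hx N.
assert (K : forall y, P y -> y < s).
{ intros y Hy; destruct (lt_trichotomy y s) as [L|[E|L]]; [exact L| |].
  - elim N; rewrite <- E; exact Hy.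
  - elim (proj1 (lt_not_le _ _) L); apply Hs, Hy. }
split.
- intros E; apply (not_lt_zero x); rewrite <- E; apply K, Hx.
- intros y E; apply (lt_irrefl s).
  destruct (lt_sup P s y Hs) as [z [Hz L]]; [rewrite E; apply lt_succ, le_refl|].
  apply (le_lt_trans _ z); [rewrite E; apply succ_le, L|apply K, Hz].
Qed.

Lemma increasing_le (f : On -> On) :
  (forall x y, x < y -> f x < f y) -> forall x, x <= f x.
Proof.
intros H x; induction (lt_wf x) as [x _ IH]; apply le_not_lt; intros L.
exact (proj1 (le_not_lt _ _) (IH _ L) (H _ _ L)).
Qed.

(** * Arithmetic of powers of omega *)

Lemma le_add_r x y : x <= x + y.
Proof. exact (proj1 (proj1 (add_le _ _ _) (le_refl _))). Qed.

Lemma add_lt x y z : y < z -> x + y < x + z.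
Proof. exact (proj2 (proj1 (add_le _ _ _) (le_refl _)) y). Qed.

Lemma le_add_l x y : y <= x + y.
Proof. exact (increasing_le (add x) (add_lt x) y). Qed.

Lemma add_cancel_l x y z : x + y = x + z -> y = z.
Proof.
intros E; destruct (lt_trichotomy y z) as [L|[L|L]]; [|exact L|];
  apply (add_lt x) in L; rewrite E in L; elim (lt_irrefl _ L).
Qed.

Lemma lt_add x y z : z < x + y -> z < x \/ exists w, w < y /\ z <= x + w.
Proof.
intros H; apply NNPP; intros N; apply (proj1 (lt_not_le _ _) H), add_le; split.
- apply le_not_lt; tauto.
- intros w Hw; apply lt_not_le; intros K; apply N; right; eauto.
Qed.

Lemma add_assoc x y z : x + y + z = x + (y + z).
Proof.
induction (lt_wf z) as [z _ IH]; apply le_antisym; apply add_le; split.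
- apply add_mono; [apply le_refl|apply le_add_r].
- intros w Hw; rewrite (IH _ Hw); apply add_lt, add_lt, Hw.
- apply (le_trans _ (x + y)); apply le_add_r.
- intros v Hv; destruct (lt_add _ _ _ Hv) as [L|[w [Hw L]]].
  + exact (lt_le_trans _ _ _ (add_lt x _ _ L) (le_add_r _ _)).
  + apply (le_lt_trans _ (x + (y + w))); [apply add_mono; [apply le_refl|exact L]|].
    rewrite <- (IH _ Hw); apply add_lt, Hw.
Qed.

Lemma le_subtract x y : x <= y -> exists z, y = x + z.
Proof.
intros H.
destruct (least_element (fun z => y <= x + z)) as [z [Hz M]];
  [exists y; apply le_add_l|].
exists z; apply le_antisym; [exact Hz|]; apply add_le; split; [exact H|].
intros w Hw; apply lt_not_le; intros K.
exact (proj1 (lt_not_le _ _) Hw (M w K)).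
Qed.

Lemma zero_or_succ_below_omega z :
  z < omega -> z = zero \/ exists y, z = succ y /\ y < z.
Proof.
intros H; apply NNPP; intros N.
apply (proj1 (lt_not_le _ _) H), omega_least; split.
- tauto.
- intros y E; apply N; right; exists y; split; [exact E|].
  rewrite E; apply lt_succ, le_refl.
Qed.

Lemma omega_induction (P : On -> Prop) :
  P zero -> (forall z, P z -> P (succ z)) -> forall z, z < omega -> P z.
Proof.
intros H0 HS z; induction (lt_wf z) as [z _ IH]; intros Hz.
destruct (zero_or_succ_below_omega z Hz) as [->|[y [E L]]]; [exact H0|].
rewrite E; apply HS, IH; [exact L|exact (lt_trans _ _ _ L Hz)].
Qed.

Lemma add_0_l x : zero + x = x.
Proof.
apply le_antisym; [|apply le_add_l].
induction (lt_wf x) as [x _ IH]; apply add_le; split; [apply zero_le|].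
intros z Hz; exact (le_lt_trans _ _ _ (IH _ Hz) Hz).
Qed.

Lemma add_mul_finite c z : z < omega -> c + c * z = c * z + c.
Proof.
revert z; apply omega_induction.
- rewrite mul_0_r, add_0_r, add_0_l; reflexivity.
- intros z E; rewrite mul_succ_r, <- add_assoc, E; reflexivity.
Qed.

Lemma add_mul_omega c : c + c * omega = c * omega.
Proof.
apply le_antisym; [|apply le_add_l]; apply add_le; split; [apply le_mul_omega|].
intros z Hz.
destruct (lt_sup _ _ _ (mul_limit_r c omega omega_limit) Hz) as [y [[n [Hn ->]] L]].
apply (lt_le_trans _ _ _ (add_lt c _ _ L)).
rewrite (add_mul_finite _ _ Hn), <- mul_succ_r.
apply mul_mono; [apply le_refl|].
apply lt_le, limit_succ; [apply omega_limit|exact Hn].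
Qed.

Lemma add_fixed_iff c x : c + x = x <-> c * omega <= x.
Proof.
split.
- intros E.
  assert (K : forall z, z < omega -> c * z <= x).
  { intros z Hz; cut (z < omega /\ c * z <= x); [tauto|]; revert z Hz.
    apply omega_induction.
    - split; [apply zero_lt_limit, omega_limit|rewrite mul_0_r; apply zero_le].
    - intros z [Hz H]; split; [apply limit_succ; [apply omega_limit|exact Hz]|].
      rewrite mul_succ_r, <- add_mul_finite, <- E by exact Hz.
      apply add_mono; [apply le_refl|exact H]. }
  apply mul_le; intros z Hz; rewrite <- mul_succ_r.
  apply K, limit_succ; [apply omega_limit|exact Hz].
- intros H; destruct (le_subtract _ _ H) as [y ->].
  rewrite <- add_assoc, add_mul_omega; reflexivity.
Qed.

Lemma add_lt_mul_omega c x : x < c * omega -> c + x < c * omega.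
Proof. intros H; rewrite <- add_mul_omega; apply add_lt, H. Qed.

Lemma omega_pow_pos a : zero < omega_pow a.
Proof.
apply succ_le; exact (proj1 (proj1 (omega_pow_le _ _) (le_refl _))).
Qed.

Lemma omega_pow_mul_omega_le a b : a < b -> omega_pow a * omega <= omega_pow b.
Proof. exact (proj2 (proj1 (omega_pow_le _ _) (le_refl _)) a). Qed.

Lemma omega_pow_lt_mul_omega a : omega_pow a < omega_pow a * omega.
Proof.
rewrite <- (add_0_r (omega_pow a)) at 1; apply add_lt_mul_omega.
exact (lt_le_trans _ _ _ (omega_pow_pos a) (le_mul_omega _)).
Qed.

Lemma omega_pow_absorb a b : a < b -> omega_pow a + omega_pow b = omega_pow b.
Proof. intros H; apply add_fixed_iff, omega_pow_mul_omega_le, H. Qed.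

Definition leading_exponent (a x : On) : Prop :=
  omega_pow a <= x /\ x < omega_pow a * omega.

Lemma leading_exponent_exists x : zero < x -> exists a, leading_exponent a x.
Proof.
intros Hx.
destruct (least_element (fun a => x < omega_pow a * omega)) as [a [Ha M]].
{ exists x; refine (le_lt_trans _ _ _ _ (omega_pow_lt_mul_omega x)).
  apply increasing_le; intros y z L.
  exact (lt_le_trans _ _ _ (omega_pow_lt_mul_omega y) (omega_pow_mul_omega_le _ _ L)). }
exists a; split; [|exact Ha]; apply omega_pow_le; split; [apply succ_le, Hx|].
intros z Hz; apply le_not_lt; intros L; exact (proj1 (lt_not_le _ _) Hz (M z L)).
Qed.

Lemma leading_exponent_unique a b x :
  leading_exponent a x -> leading_exponent b x -> a = b.
Proof.
assert (K : forall a b, leading_exponent a x -> leading_exponent b x -> ~ a < b).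
{ intros c d [_ H1] [H2 _] L.
  apply (proj1 (lt_not_le _ _) H1).
  exact (le_trans _ _ _ (omega_pow_mul_omega_le _ _ L) H2). }
intros Ha Hb; destruct (lt_trichotomy a b) as [L|[L|L]]; [|exact L|].
- elim (K a b Ha Hb L).
- elim (K b a Hb Ha L).
Qed.

Lemma leading_exponent_remainder a y :
  leading_exponent a (omega_pow a + y) -> y < omega_pow a + y.
Proof.
intros [_ H]; destruct (lt_trichotomy y (omega_pow a + y)) as [L|[E|L]];
  [exact L| |].
- elim (proj1 (lt_not_le _ _) H); rewrite <- E; apply add_fixed_iff; auto.
- elim (proj1 (lt_not_le _ _) L); apply le_add_l.
Qed.

(** * Normal functions and enumerations of closed unbounded classes *)

Lemma normal_mono f x y : normal f -> x <= y -> f x <= f y.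
Proof.
intros [I _] H; destruct (lt_trichotomy x y) as [L|[->|L]].
- exact (lt_le _ _ (I _ _ L)).
- apply le_refl.
- elim (proj1 (le_not_lt _ _) H L).
Qed.

Lemma normal_id : normal (fun x => x).
Proof.
split; [auto|]; intros l Hl; split.
- intros u [x [Hx ->]]; exact (lt_le _ _ Hx).
- intros u H; apply le_not_lt; intros L.
  apply (lt_irrefl u), succ_le, H; exists (succ u); split; [|reflexivity].
  apply limit_succ; assumption.
Qed.

Lemma normal_limit f l : normal f -> limit l -> limit (f l).
Proof.
intros [I C] Hl.
apply (sup_limit _ _ (f zero) (C l Hl)).
- exists zero; split; [apply zero_lt_limit, Hl|reflexivity].
- intros [x [Hx E]]; apply I in Hx; rewrite E in Hx; exact (lt_irrefl _ Hx).
Qed.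

Lemma normal_comp f g : normal f -> normal g -> normal (fun x => f (g x)).
Proof.
intros Nf Ng; split; [intros x y L; apply Nf, Ng, L|].
intros l Hl; split.
- intros u [x [Hx ->]]; apply lt_le, Nf, Ng, Hx.
- intros u H; apply (proj2 Nf (g l) (normal_limit _ _ Ng Hl)).
  intros v [y [Hy ->]].
  destruct (lt_sup _ _ _ (proj2 Ng l Hl) Hy) as [z [[w [Hw ->]] L]].
  apply (le_trans _ (f (g w))); [apply lt_le, Nf, L|apply H; eauto].
Qed.

Definition closed (P : On -> Prop) : Prop :=
  forall (Q : On -> Prop) s, (forall x, Q x -> P x) -> (exists x, Q x) -> is_sup Q s -> P s.

Definition unbounded (P : On -> Prop) : Prop := forall x, exists y, x <= y /\ P y.

Lemma enumeration_exists P : closed P -> unbounded P -> exists e, is_enumeration P e.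
Proof.
intros HC HU.
set (spec := fun z (rec : forall w, w < z -> On) y =>
  (P y /\ forall w (Hw : w < z), rec w Hw < y) /\
  forall y', P y' /\ (forall w (Hw : w < z), rec w Hw < y') -> y <= y').
set (e := Fix lt_wf (fun _ => On) (fun z rec => epsilon (inhabits zero) (spec z rec))).
assert (E : forall z, e z = epsilon (inhabits zero) (spec z (fun w _ => e w))).
{ intros z; unfold e at 1; rewrite Fix_eq; [reflexivity|].
  intros a r r' E; replace r' with r; [reflexivity|].
  apply functional_extensionality_dep; intros w.
  apply functional_extensionality_dep; intros Hw; apply E. }
assert (S : forall z, spec z (fun w _ => e w) (e z)).
{ intros z; rewrite (E z); apply epsilon_spec, least_element.
  destruct (below_bounded z e) as [s Hs]; destruct (HU s) as [y [L Hy]].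
  exists y; split; [exact Hy|]; intros w Hw; exact (lt_le_trans _ _ _ (Hs w Hw) L). }
clearbody e; clear E.
assert (I : forall x y, x < y -> e x < e y) by (intros; apply S; assumption).
exists e; split; [split; [exact I|]|].
- intros l Hl.
  assert (B : forall x, (exists w, w < l /\ x = e w) -> x <= e l).
  { intros x [w [Hw ->]]; apply lt_le, I, Hw. }
  destruct (sup_exists _ _ B) as [s Hs].
  split; [exact B|]; intros u Hu; apply (le_trans _ s); [|apply Hs, Hu].
  apply S; split.
  + refine (HC _ s _ _ Hs).
    * intros x [w [_ ->]]; apply S.
    * exists (e zero), zero; split; [apply zero_lt_limit, Hl|reflexivity].
  + intros w Hw; apply (lt_le_trans _ (e (succ w))); [apply I, lt_succ, le_refl|].
    apply Hs; exists (succ w); split; [apply limit_succ; assumption|reflexivity].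
- intros x; split; [|intros [z <-]; apply S].
  intros Hx.
  destruct (least_element (fun z => x <= e z)) as [z [Hz M]];
    [exists x; apply increasing_le, I|].
  exists z; apply le_antisym; [|exact Hz]; apply S; split; [exact Hx|].
  intros w Hw; apply lt_not_le; intros K; exact (proj1 (lt_not_le _ _) Hw (M w K)).
Qed.

Lemma enumeration_le P e g :
  is_enumeration P e -> (forall x y, x < y -> g x < g y) -> (forall x, P (g x)) ->
  forall x, e x <= g x.
Proof.
intros [[I _] R] J HP x; induction (lt_wf x) as [x _ IH].
destruct (proj1 (R _) (HP x)) as [z Hz]; rewrite <- Hz.
apply le_not_lt; intros L.
assert (K : z < x).
{ destruct (lt_trichotomy z x) as [K|[K|K]]; [exact K| |].
  - rewrite K in L; elim (lt_irrefl _ L).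
  - elim (lt_irrefl _ (lt_trans _ _ _ L (I _ _ K))). }
apply (lt_irrefl (e z)), (le_lt_trans _ _ _ (IH z K)).
rewrite Hz; apply J, K.
Qed.

Section CommonFixedPoints.

Variables (F : On -> On -> On) (a : On).
Hypothesis F_normal : forall b, b < a -> normal (F b).

Let common_fixed x := forall b, b < a -> F b x = x.

Lemma common_fixed_closed : closed common_fixed.
Proof.
intros Q s HQ [x Hx] Hs b Hb.
destruct (classic (Q s)) as [K|K]; [exact (HQ s K b Hb)|].
apply le_antisym; [|apply increasing_le, F_normal, Hb].
apply (proj2 (F_normal b Hb) s (sup_limit _ _ _ Hs Hx K)).
intros u [y [Hy ->]]; destruct (lt_sup _ _ _ Hs Hy) as [q [Hq L]].
apply (le_trans _ q); [|apply Hs, Hq].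
rewrite <- (HQ q Hq b Hb); apply lt_le, F_normal; assumption.
Qed.

Lemma common_fixed_unbounded : unbounded common_fixed.
Proof.
intros x.
assert (B : forall y, exists s, y < s /\ forall b, b < a -> F b y < s).
{ intros y; destruct (below_bounded a (fun b => F b y)) as [s Hs].
  exists (succ y + s); split.
  - apply succ_le, le_add_r.
  - intros b Hb; exact (lt_le_trans _ _ _ (Hs b Hb) (le_add_l _ _)). }
destruct (choice _ B) as [nxt Hnxt].
set (y := fun n => nat_rect (fun _ => On) x (fun _ => nxt) n).
destruct (family_bounded nat y) as [u Hu].
destruct (sup_exists (fun v => exists n, v = y n) u) as [s Hs].
{ intros v [n ->]; apply lt_le, Hu. }
assert (L : forall n, y n < s).
{ intros n; apply (lt_le_trans _ (y (S n))); [apply Hnxt|apply Hs; eauto]. }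
exists s; split; [exact (lt_le _ _ (L 0))|]; intros b Hb.
apply le_antisym; [|apply increasing_le, F_normal, Hb].
apply (proj2 (F_normal b Hb) s).
- apply (sup_limit _ _ (y 0) Hs); [eauto|].
  intros [n E]; apply (lt_irrefl s); rewrite E at 1; apply L.
- intros v [z [Hz ->]]; destruct (lt_sup _ _ _ Hs Hz) as [w [[n ->] K]].
  apply (le_trans _ (F b (y n))); [apply lt_le, F_normal; assumption|].
  apply (le_trans _ (y (S n))); [apply lt_le, (proj2 (Hnxt (y n)) b Hb)|].
  apply Hs; eauto.
Qed.

End CommonFixedPoints.

(** * The Veblen progression *)

Lemma enum_spec P : closed P -> unbounded P -> is_enumeration P (enum P).
Proof. intros HC HU; exact (epsilon_spec _ _ (enumeration_exists P HC HU)). Qed.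

Lemma zero_or_pos a : a = zero \/ zero < a.
Proof.
destruct (lt_trichotomy zero a) as [L|[L|L]]; auto; elim (not_lt_zero _ L).
Qed.

Section Hyperation.

Variable f : On -> On.
Hypothesis f_normal : normal f.

Lemma Veb_normal a : normal (Veb f a).
Proof.
induction (lt_wf a) as [a _ IH]; destruct (zero_or_pos a) as [->|H].
- rewrite Veb_0; exact f_normal.
- rewrite Veb_pos by exact H.
  apply enum_spec; [apply common_fixed_closed|apply common_fixed_unbounded]; exact IH.
Qed.

Lemma Veb_enumeration a :
  zero < a -> is_enumeration (fun x => forall b, b < a -> Veb f b x = x) (Veb f a).
Proof.
intros H; rewrite (Veb_pos f a H).
apply enum_spec; [apply common_fixed_closed|apply common_fixed_unbounded];
  intros b _; apply Veb_normal.
Qed.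

Lemma Veb_absorb a b x : b < a -> Veb f b (Veb f a x) = Veb f a x.
Proof.
intros H.
assert (Ha : zero < a) by (exact (le_lt_trans _ _ _ (zero_le b) H)).
apply (proj2 (proj2 (Veb_enumeration a Ha) _)); eauto.
Qed.

Lemma Veb_le_weak_hyperation h :
  weak_hyperation f h -> forall a x, Veb f a x <= h (omega_pow a) x.
Proof.
intros [Hn [_ [H1 Hadd]]] a; induction (lt_wf a) as [a _ IH].
destruct (zero_or_pos a) as [->|Ha].
- intros x; rewrite Veb_0, omega_pow_0, H1; apply le_refl.
- apply (enumeration_le _ _ _ (Veb_enumeration a Ha)); [apply Hn|].
  intros x b Hb; apply le_antisym; [|apply increasing_le, Veb_normal].
  rewrite <- (omega_pow_absorb b a Hb) at 2; rewrite Hadd; apply IH, Hb.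
Qed.

(* [Veb_sum x g]: for some expression of [x] as a finite sum of powers of omega,
   in which the exponents need not decrease, [g] is the corresponding composite. *)
Inductive Veb_sum : On -> (On -> On) -> Prop :=
| Veb_sum_nil : Veb_sum zero (fun z => z)
| Veb_sum_cons a x g :
    Veb_sum x g -> Veb_sum (omega_pow a + x) (fun z => Veb f a (g z)).

Lemma Veb_sum_add x y g h :
  Veb_sum x g -> Veb_sum y h -> Veb_sum (x + y) (fun z => g (h z)).
Proof.
intros Hx Hy; induction Hx as [|a x g _ IH].
- rewrite add_0_l; exact Hy.
- rewrite add_assoc; exact (Veb_sum_cons a _ _ IH).
Qed.

Lemma Veb_sum_omega_pow a : Veb_sum (omega_pow a) (Veb f a).
Proof.
rewrite <- (add_0_r (omega_pow a)); exact (Veb_sum_cons a _ _ Veb_sum_nil).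
Qed.

Lemma Veb_sum_leading x g : Veb_sum x g ->
  (x = zero /\ g = fun z => z) \/
  exists a y h, leading_exponent a x /\ x = omega_pow a + y /\
    Veb_sum y h /\ g = fun z => Veb f a (h z).
Proof.
induction 1 as [|b x g Hx IH]; [left; auto|right].
assert (K : x < omega_pow b * omega -> exists a y h,
  leading_exponent a (omega_pow b + x) /\ omega_pow b + x = omega_pow a + y /\
  Veb_sum y h /\ (fun z => Veb f b (g z)) = fun z => Veb f a (h z)).
{ intros L; exists b, x, g; repeat split; auto using le_add_r, add_lt_mul_omega. }
destruct IH as [[-> _]|[a [y [h [[H1 H2] [Ey [Hy Eg]]]]]]].
- apply K; exact (lt_trans _ _ _ (omega_pow_pos b) (omega_pow_lt_mul_omega b)).
- destruct (le_or_lt a b) as [L|L].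
  + apply K, (lt_le_trans _ _ _ H2), mul_mono; [apply omega_pow_mono, L|apply le_refl].
  + exists a, y, h.
    rewrite (proj2 (add_fixed_iff (omega_pow b) x));
      [|exact (le_trans _ _ _ (omega_pow_mul_omega_le _ _ L) H1)].
    repeat split; auto.
    apply functional_extensionality; intros z; rewrite Eg; apply Veb_absorb, L.
Qed.

Lemma Veb_sum_unique x g g' : Veb_sum x g -> Veb_sum x g' -> g = g'.
Proof.
revert g g'; induction (lt_wf x) as [x _ IH]; intros g g' H H'.
assert (K : forall a, ~ leading_exponent a zero).
{ intros a [L _]; exact (proj1 (le_not_lt _ _) L (omega_pow_pos a)). }
destruct (Veb_sum_leading _ _ H) as [[Ex ->]|[a [y [h [Ha [Ey [Hy ->]]]]]]];
  destruct (Veb_sum_leading _ _ H') as [[Ex' ->]|[a' [y' [h' [Ha' [Ey' [Hy' ->]]]]]]].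
- reflexivity.
- rewrite Ex in Ha'; elim (K _ Ha').
- rewrite Ex' in Ha; elim (K _ Ha).
- rewrite (leading_exponent_unique _ _ _ Ha' Ha) in *.
  assert (E : y' = y) by (apply (add_cancel_l (omega_pow a)); congruence).
  rewrite E in Hy'; rewrite (IH y) with (g := h) (g' := h'); auto.
  rewrite Ey in Ha |- *; apply leading_exponent_remainder, Ha.
Qed.

Lemma Veb_sum_exists x : exists g, Veb_sum x g.
Proof.
induction (lt_wf x) as [x _ IH]; destruct (zero_or_pos x) as [->|H].
- eexists; apply Veb_sum_nil.
- destruct (leading_exponent_exists x H) as [a Ha].
  destruct (le_subtract _ _ (proj1 Ha)) as [y E]; rewrite E in *.
  destruct (IH y (leading_exponent_remainder _ _ Ha)) as [g Hg].
  eexists; apply Veb_sum_cons, Hg.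
Qed.

Lemma Veb_sum_normal x g : Veb_sum x g -> normal g.
Proof.
induction 1 as [|a x g _ IH]; [apply normal_id|].
exact (normal_comp _ _ (Veb_normal a) IH).
Qed.

Lemma Veb_sum_le_weak_hyperation h x g :
  weak_hyperation f h -> Veb_sum x g -> forall z, g z <= h x z.
Proof.
intros Hh; induction 1 as [|a x g _ IH]; intros z.
- rewrite (proj1 (proj2 Hh)); apply le_refl.
- rewrite (proj2 (proj2 (proj2 Hh))).
  apply (le_trans _ (Veb f a (h x z))); [apply normal_mono; [apply Veb_normal|apply IH]|].
  apply Veb_le_weak_hyperation, Hh.
Qed.

Lemma Veb_sum_hyperation g : (forall x, Veb_sum x (g x)) -> is_hyperation f g.
Proof.
intros Hg; repeat apply conj.
- intros x; exact (Veb_sum_normal _ _ (Hg x)).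
- intros z; rewrite (Veb_sum_unique _ _ _ (Hg zero) Veb_sum_nil); reflexivity.
- intros z; rewrite <- omega_pow_0.
  rewrite (Veb_sum_unique _ _ _ (Hg _) (Veb_sum_omega_pow zero)), Veb_0; reflexivity.
- intros x y z.
  rewrite (Veb_sum_unique _ _ _ (Hg _) (Veb_sum_add _ _ _ _ (Hg x) (Hg y))).
  reflexivity.
- intros h Hh x; exact (Veb_sum_le_weak_hyperation h x _ Hh (Hg x)).
Qed.

Lemma Veb_sum_Hyp x : Veb_sum x (Hyp f x).
Proof.
destruct (choice _ Veb_sum_exists) as [g Hg].
assert (E : Hyp f = g).
{ apply (hyperation_unique f); [|exact (Veb_sum_hyperation g Hg)].
  exact (epsilon_spec _ _ (ex_intro _ g (Veb_sum_hyperation g Hg))). }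
rewrite E; apply Hg.
Qed.

End Hyperation.

Theorem lemma4p9 : forall f : On -> On, normal f ->
  forall alpha : On, Hyp f (omega_pow alpha) = Veb f alpha.
Proof.
intros f Hf alpha.
exact (Veb_sum_unique f Hf _ _ _ (Veb_sum_Hyp f Hf _) (Veb_sum_omega_pow f alpha)).
Qed.
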